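(* Let $k$ and $n$ be non-negative integers. Let $p_1,p_2,\ldots,p_{k+1}$ be odd primes such that $p_i\not\equiv 1 \pmod 4$ for each $1\leq i\leq k+1$. Then for any integer $j\not\equiv 0 \pmod{p_{k+1}}$, $$\bar{B}_{5,2}\left(4p_1^2p_2^2\cdots p_k^2p_{k+1}^2 n + (4j+p_{k+1})p_1^2p_2^2\cdots p_k^2 p_{k+1}\right)\equiv 0 \pmod 4.$$
   Context: An overpartition of a positive integer $n$ is a partition of $n$ in which the first occurrence of each distinct part may be overlined. For coprime integers $\ell_1,\ell_2>1$, $\bar{B}_{\ell_1,\ell_2}(n)$ denotes the number of overpartitions of $n$ in which no part is divisible by $\ell_1$ or by $\ell_2$, with $\bar{B}_{\ell_1,\ell_2}(0)=1$. *)

(* Defs.v *)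
From mathcomp Require Import all_boot all_order all_algebra.
Set Implicit Arguments.
Unset Strict Implicit.
Unset Printing Implicit Defensive.

(* A part is a pair (size, overlined?).  Parts are listed in weakly decreasing
   order, so equal parts are adjacent and the i-th entry is the first
   occurrence of its size exactly when [index] returns i. *)
Definition overpartition (n : nat) (s : seq (nat * bool)) : bool :=
  [&& sorted geq (unzip1 s),
      all (leq 1) (unzip1 s),
      sumn (unzip1 s) == n &
      [forall i : 'I_(size s),
         (nth (0, false) s i).2 ==>
         (index (nth (0, false) s i).1 (unzip1 s) == i)]].

Definition regular_parts (l1 l2 : nat) (s : seq (nat * bool)) : bool :=
  all (fun a => ~~ (l1 %| a) && ~~ (l2 %| a)) (unzip1 s).

Lemma overpartition_bounds (n : nat) (s : seq (nat * bool)) :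
  overpartition n s -> size s <= n /\ all (fun a => a <= n) (unzip1 s).
Proof.
case/and4P=> _ pos /eqP <- _; rewrite -(size_map fst s) -/(unzip1 s).
elim: (unzip1 s) pos => //= a t IH /andP[a_gt0 /IH[le_t le_a]]; split.
  by rewrite -add1n leq_add.
rewrite leq_addr; apply: sub_all le_a => b le_b.
exact: leq_trans le_b (leq_addl _ _).
Qed.

(* By overpartition_bounds, summing over the number of parts r <= n and over
   r-tuples of parts of size <= n loses nothing. *)
Definition num_overpartitions (l1 l2 n : nat) : nat :=
  \sum_(r < n.+1)
    #|[set t : r.-tuple ('I_n.+1 * bool) |
        let s := [seq (nat_of_ord x.1, x.2) | x <- t] in
        overpartition n s && regular_parts l1 l2 s]|.

(* Indexed by int, with the usual convention that a negative integer has no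
   overpartitions. *)
Definition Bbar (l1 l2 : nat) (m : int) : nat :=
  match m with
  | Posz n => num_overpartitions l1 l2 n
  | Negz _ => 0
  end.

(* Main.v *)
(* A partition with d distinct part sizes underlies 2^d overpartitions, so
   modulo 4 only the partitions n = r * m with a single part size m count, each
   contributing 2. Hence Bbar(n) is congruent to twice the number of regular
   divisors m of n. That number is even as soon as some p prime to l1 and l2
   has odd exponent in n, and here p_{k+1} has odd exponent. *)

Require Import Defs.
From mathcomp Require Import all_boot all_order all_algebra.
From mathcomp Require Import ring.
Set Implicit Arguments.
Unset Strict Implicit.
Unset Printing Implicit Defensive.
Import GRing.Theory.

(** Each orbit is a pair [x], [f x]. Enumeration ranks tell its two elements apart, and [f] maps the
    lower ones bijectively onto the upper ones. *)
Lemma even_card_involution (T : finType) (A : {set T}) (f : T -> T) :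
  {in A, forall x, f x \in A} -> {in A, forall x, f (f x) = x} ->
  {in A, forall x, f x != x} -> 2 %| #|A|.
Proof.
move=> fA fK f_neq.
pose up := [set x in A | enum_rank x < enum_rank (f x)].
pose dn := [set x in A | enum_rank (f x) < enum_rank x].
have dnE : dn = f @: up.
  apply/setP=> y; apply/idP/imsetP => [|[x]]; rewrite !inE => /andP[yA lt_y].
    by exists (f y); rewrite ?inE ?fA ?fK.
  by move=> ->; rewrite fA ?fK.
have card_dn : #|dn| = #|up|.
  rewrite dnE card_in_imset // => x y; rewrite !inE => /andP[xA _] /andP[yA _].
  by move/(congr1 f); rewrite !fK.
have AE : A = up :|: dn.
  apply/setP=> x; rewrite !inE -andb_orr -neq_ltn.
  case xA: (x \in A) => //=; apply/esym; apply: contraNneq (f_neq _ xA).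
  by move=> eq_rank; apply/eqP/enum_rank_inj/ord_inj.
have disj : up :&: dn = set0.
  apply/setP=> x; rewrite !inE; apply/negP => /andP[/andP[_ lt1] /andP[_ lt2]].
  by have := ltn_trans lt1 lt2; rewrite ltnn.
by rewrite AE cardsU disj cards0 subn0 card_dn addnn -muln2 dvdn_mull.
Qed.

(** For [r] dividing [n], the exponent [e] of [p] in [r] becomes [logn p n - e]; other primes keep
    their exponents. *)
Definition swap_part (p n r : nat) : nat := r`_p^' * (n %/ r)`_p.

Lemma div_swap_part (p n r : nat) :
  0 < n -> r %| n -> swap_part p n r * ((n %/ r)`_p^' * r`_p) = n.
Proof.
move=> n_gt0 r_n; have r_gt0 := dvdn_gt0 n_gt0 r_n.
have m_gt0 : 0 < n %/ r by rewrite divn_gt0 // dvdn_leq.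
rewrite /swap_part [_ * r`_p]mulnC mulnACA [_ * r`_p]mulnC.
by rewrite !partnC // mulnC divnK.
Qed.

(* Swapping the p-parts of r and n/r is a fixed-point-free involution, since
   the p-parts of r and n/r differ when their product has odd exponent. *)
Lemma even_regular_codivisors (l1 l2 p n : nat) :
  coprime l1 p -> coprime l2 p -> odd (logn p n) ->
  2 %| #|[set r : 'I_n.+1 | (r %| n) &&
                (~~ (l1 %| n %/ r) && ~~ (l2 %| n %/ r))]|.
Proof.
move=> l1p l2p odd_p; set A := [set r | _].
have n_gt0 : 0 < n by case: n odd_p {A}; rewrite ?logn0.
have swap_dvd r : r %| n -> swap_part p n r %| n.
  by move=> r_n; rewrite -{2}(div_swap_part p n_gt0 r_n) dvdn_mulr.
have val_swap r : r %| n ->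
    nat_of_ord (inord (swap_part p n r) : 'I_n.+1) = swap_part p n r.
  by move=> r_n; rewrite inordK // ltnS dvdn_leq ?swap_dvd.
have n_div_swap r : r %| n -> n %/ swap_part p n r = (n %/ r)`_p^' * r`_p.
  move=> r_n; rewrite -{1}(div_swap_part p n_gt0 r_n) mulKn //.
  exact: dvdn_gt0 n_gt0 (swap_dvd _ r_n).
have part_swap r : r %| n -> (swap_part p n r)`_p = (n %/ r)`_p.
  move=> r_n; rewrite /swap_part partnM ?part_gt0 // part_p'nat ?part_pnat //.
  by rewrite mul1n part_pnat_id ?part_pnat.
have partC_swap r : r %| n -> (swap_part p n r)`_p^' = r`_p^'.
  move=> r_n; rewrite /swap_part partnM ?part_gt0 // part_pnat_id ?part_pnat //.
  by rewrite [_`_p`_p^']part_p'nat ?muln1 // pnatNK part_pnat.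
apply: (@even_card_involution _ A (fun r : 'I_n.+1 => inord (swap_part p n r))) => r;
  rewrite inE => /andP[r_n /andP[reg1 reg2]].
- rewrite inE val_swap // swap_dvd //= n_div_swap //.
  (* As [l] is prime to [p], only the prime-to-[p] part of a codivisor matters, and the swap
     preserves it. *)
  have reg l : coprime l p -> ~~ (l %| n %/ r) ->
      ~~ (l %| (n %/ r)`_p^' * r`_p).
    move=> lp; apply: contra; rewrite Gauss_dvdl ?p_part ?coprimeXr //.
    by move/dvdn_trans; apply; apply: dvdn_part.
  by rewrite !reg.
- apply: val_inj; rewrite /= val_swap ?val_swap ?swap_dvd //.
  rewrite {1}/swap_part partC_swap // n_div_swap // partnM ?part_gt0 //.
  rewrite [_`_p^'`_p]part_p'nat ?part_pnat // mul1n.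
  rewrite [_`_p`_p]part_pnat_id ?part_pnat // mulnC.
  by rewrite partnC // (dvdn_gt0 n_gt0 r_n).
- apply/eqP => /(congr1 val) /=; rewrite val_swap // => /(congr1 (partn^~ p)).
  rewrite part_swap // => /(congr1 (logn p)); rewrite !logn_part => eq_log.
  move: odd_p; rewrite -(divnK r_n) lognM ?(dvdn_gt0 n_gt0 r_n) //.
    by rewrite eq_log addnn odd_double.
  by rewrite divn_gt0 ?(dvdn_gt0 n_gt0 r_n) // dvdn_leq.
Qed.

(** The positions where an overline is allowed, one for each distinct entry. *)
Definition first_occurrences (r : nat) (T : eqType) (u : r.-tuple T) :
    {set 'I_r} :=
  [set i | index (tnth u i) u == i].

Definition regular_partition (l1 l2 n : nat) (u : seq nat) : bool :=
  [&& sorted geq u, all (leq 1) u, sumn u == n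
    & all (fun a => ~~ (l1 %| a) && ~~ (l2 %| a)) u].

(** Overpartitions are grouped by their underlying partition [u]; the overlined positions then range
    over all subsets of its first occurrences. *)
Lemma num_overpartitionsE (l1 l2 n : nat) :
  num_overpartitions l1 l2 n =
  \sum_(r < n.+1)
    \sum_(u : r.-tuple 'I_n.+1 | regular_partition l1 l2 n (map val u))
      2 ^ #|first_occurrences u|.
Proof.
have ovE r (t : r.-tuple ('I_n.+1 * bool)) :
    (let s := [seq (nat_of_ord x.1, x.2) | x <- t] in
     overpartition n s && regular_parts l1 l2 s) =
    regular_partition l1 l2 n (map val (map_tuple fst t)) &&
      ([set i | (tnth t i).2] \subset first_occurrences (map_tuple fst t)).
  rewrite /overpartition /regular_parts /regular_partition /=.
  set s := map _ t.
  have -> : unzip1 s = map val (map fst t) by rewrite /unzip1 -!map_comp.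
  rewrite -!andbA; do 3!congr (_ && _); rewrite andbC; congr (_ && _).
  have nth_s (i : 'I_r) :
      nth (0, false) s i = (nat_of_ord (tnth t i).1, (tnth t i).2).
    by rewrite (nth_map (tnth t i)) ?size_tuple // -tnth_nth.
  have size_s : size s = r by rewrite size_map size_tuple.
  apply/forallP/subsetP => [H i | H i].
    have := H (cast_ord (esym size_s) i); rewrite /= nth_s !inE tnth_map /=.
    by rewrite (index_map (@ord_inj _)) => /implyP.
  apply/implyP; have := H (cast_ord size_s i); rewrite !inE tnth_map.
  rewrite -[nat_of_ord i]/(nat_of_ord (cast_ord size_s i)) nth_s /=.
  by rewrite (index_map (@ord_inj _)).
apply: eq_bigr => r _; rewrite -sum1_card.
rewrite (partition_big (fun t : r.-tuple _ => map_tuple fst t)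
          (fun u : r.-tuple 'I_n.+1 => regular_partition l1 l2 n (map val u))).
  apply: eq_bigr => u u_reg; rewrite -card_powerset.
  (* [f] overlines [u] exactly at [A], so the fibre over [u] is the image of a powerset. *)
  pose f (A : {set 'I_r}) := [tuple (tnth u i, i \in A) | i < r].
  have f_inj : injective f.
    move=> A B /(congr1 (fun t => tnth t)) eqf; apply/setP => i.
    by have := congr1 (fun t => (t i).2) eqf; rewrite !tnth_mktuple.
  rewrite -(card_imset _ f_inj) -sum1_card; apply: eq_bigl => t.
  rewrite inE ovE; apply/andP/imsetP => [[/andP[_ sub_t] /eqP tu]|[A]].
    exists [set i | (tnth t i).2]; first by rewrite inE -tu.
    apply: eq_from_tnth => i; rewrite tnth_mktuple inE -tu tnth_map.
    by case: (tnth t i).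
  rewrite inE => sub_A ->.
  have fu : map_tuple fst (f A) = u.
    by apply: eq_from_tnth => i; rewrite tnth_map tnth_mktuple.
  rewrite fu u_reg eqxx; split=> //; apply: subset_trans sub_A.
  by apply/subsetP => i; rewrite inE tnth_mktuple.
by move=> t; rewrite inE ovE => /andP[].
Qed.

(** The head and the first entry that differs from it give two such positions. *)
Lemma card_first_occurrences_nonconstant (r : nat) (T : eqType)
    (u : r.-tuple T) :
  ~~ constant u -> 1 < #|first_occurrences u|.
Proof.
case: r u => [|r] u; first by rewrite [u]tuple0.
case/tupleP: u => x s /= /allPn[y ys /= yx]; apply/card_gt1P.
have lt_y : index y (x :: s) < r.+1.
  by rewrite -[r.+1](size_tuple [tuple of x :: s]) index_mem inE ys orbT.
exists ord0, (Ordinal lt_y); split; rewrite ?inE ?(tnth_nth x).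
- by rewrite /= eqxx.
- by rewrite [nth _ _ _]nth_index // inE ys orbT.
- by rewrite -val_eqE /= [x == y]eq_sym (negPf yx).
Qed.

Lemma card_first_occurrences_nseq (r : nat) (T : eqType) (x : T) :
  #|first_occurrences [tuple of nseq r.+1 x]| = 1.
Proof.
rewrite -(cards1 (ord0 : 'I_r.+1)); apply: eq_card => i.
by rewrite !inE (tnth_nth x) nth_nseq ltn_ord /= eqxx eq_sym.
Qed.

(** The divisor [r] counts the parts, so regularity is tested on the common part [n %/ r]. The sums
    are compared term by term in [r]. *)
Lemma num_overpartitions_mod4 (l1 l2 n : nat) : 0 < n ->
  num_overpartitions l1 l2 n =
  2 * #|[set r : 'I_n.+1 | (r %| n) &&
               (~~ (l1 %| n %/ r) && ~~ (l2 %| n %/ r))]| %[mod 4].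
Proof.
move=> n_gt0; rewrite num_overpartitionsE -sum1_card big_distrr /=.
rewrite [in RHS]big_mkcond /=.
rewrite -modn_summ; congr (_ %% 4); apply: eq_bigr => -[[|r] lt_r] _ /=.
  (* With no parts both sides vanish, since [n] is positive. *)
  rewrite inE /= dvd0n eqn0Ngt n_gt0 big_pred0 // => u.
  by rewrite [u]tuple0 /regular_partition /= eq_sym eqn0Ngt n_gt0.
(* The only candidate with equal parts; if [r.+1] does not divide [n], the rounded quotient gives
   the wrong sum. *)
set c : r.+1.-tuple 'I_n.+1 := [tuple of nseq r.+1 (inord (n %/ r.+1))].
have val_c : map val c = nseq r.+1 (n %/ r.+1).
  by rewrite map_nseq /= inordK // ltnS leq_div.
have dvd4 u : ~~ constant (u : r.+1.-tuple 'I_n.+1) ->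
    4 %| 2 ^ #|first_occurrences u|.
  by move/card_first_occurrences_nonconstant; apply: (@dvdn_exp2l 2 2).
have c_reg : regular_partition l1 l2 n (map val c) =
    (r.+1 %| n) && (~~ (l1 %| n %/ r.+1) && ~~ (l2 %| n %/ r.+1)).
  rewrite val_c /regular_partition sumn_nseq !all_nseq -dvdn_eq /=.
  have -> : path geq (n %/ r.+1) (nseq r (n %/ r.+1)).
    by move: (n %/ _) => a; elim: (r) => //= i ->; rewrite leqnn.
  case r_n: (r.+1 %| n); rewrite ?andbF //= divn_gt0 //.
  by rewrite dvdn_leq.
have const_u (u : r.+1.-tuple 'I_n.+1) :
    regular_partition l1 l2 n (map val u) -> constant u -> u = c.
  case/and4P=> _ _ /eqP sum_u _ /(constantP ord0)[a]; rewrite size_tuple => u_a.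
  have n_a : n = val a * r.+1 by rewrite -sumn_nseq -map_nseq -u_a.
  have a_val : n %/ r.+1 = val a by rewrite [X in X %/ _]n_a mulnK.
  by apply: val_inj; rewrite /= u_a a_val inord_val.
(* If [c] is admissible it contributes 2 and all other terms are multiples of 4; otherwise every
   term is a multiple of 4. *)
rewrite inE /=; case: ifP => P_r.
  rewrite (bigD1 c) ?c_reg //= card_first_occurrences_nseq.
  rewrite -modnDmr [X in (_ + X) %% 4](_ : _ = 0) //; apply/eqP.
  apply: dvdn_sum => u /andP[u_reg u_c]; apply: dvd4.
  by apply: contra u_c => /(const_u _ u_reg)/eqP.
apply/eqP/dvdn_sum => u u_reg; apply: dvd4; apply/negP => /(const_u _ u_reg) uc.
by rewrite uc c_reg P_r in u_reg.
Qed.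

Lemma num_overpartitions_dvd4 (l1 l2 p n : nat) :
  coprime l1 p -> coprime l2 p -> odd (logn p n) ->
  4 %| num_overpartitions l1 l2 n.
Proof.
move=> l1p l2p odd_p.
(* [logn p 0] is 0, which is even. *)
have n_gt0 : 0 < n by case: n odd_p; rewrite ?logn0.
rewrite /dvdn num_overpartitions_mod4 //.
exact: (@dvdn_mul 2 _ 2 _ (dvdnn 2) (even_regular_codivisors l1p l2p odd_p)).
Qed.

Local Open Scope ring_scope.

Theorem theorem5p2 (k n : nat) (p : nat -> nat)
  (hp : forall i : nat, (1 <= i <= k.+1)%N ->
     [/\ prime (p i), odd (p i) & p i <> 1 %[mod 4]])
  (j : int) (hj : (j <> 0 %[mod (p k.+1)%:Z])%Z) :
  (Bbar 5 2
     (4 * (\prod_(1 <= i < k.+1) (p i)%:Z ^+ 2) * (p k.+1)%:Z ^+ 2 * n%:Z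
      + (4 * j + (p k.+1)%:Z) * (\prod_(1 <= i < k.+1) (p i)%:Z ^+ 2)
        * (p k.+1)%:Z)
   = 0 %[mod 4])%N.
Proof.
have [] := hp k.+1; first by rewrite ltnS leqnn andbT.
set q := p k.+1; set P := \prod_(1 <= i < k.+1) _ => q_pr q_odd q_mod4.
set N := (X in Bbar 5 2 X).
have q_gt0 := prime_gt0 q_pr.
(* The cofactor left after taking [P * q] out of [N]. Modulo [q] it is [4 * j], hence nonzero
   because [q] is odd and does not divide [j]. *)
set w := 4 * (q%:Z * n%:Z + j) + q%:Z.
set Q := \prod_(1 <= i < k.+1) (p i)%:Z.
have Nabs : `|N|%N = (`|Q| ^ 2 * q * `|w|)%N.
  rewrite -[in RHS](absz_nat q) -abszX -!abszM; congr `|_|%N.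
  by rewrite /N /P /Q /w prodrXl; ring.
have q_ndvd_w : ~~ (q %| `|w|)%N.
  rewrite -[q]absz_nat -dvdzE /w rpredDr // Gauss_dvdzr.
    rewrite rpredDl ?dvdz_mulr //; apply/negP => /dvdz_mod0P j0.
    by apply: hj; rewrite mod0z.
  by rewrite coprimezE; apply: (@coprimeXr 2 q 2); rewrite coprimen2.
(* Some earlier [p i] may equal [q], but [Q] enters squared and adds an even exponent; [q] itself
   adds 1 and [w] adds 0. *)
have odd_q : odd (logn q `|N|%N).
  have w_gt0 : (0 < `|w|)%N by case: (`|w|)%N q_ndvd_w; rewrite ?dvdn0.
  have Q_gt0 : (0 < `|Q|)%N.
    rewrite absz_gt0 prodf_seq_neq0; apply/allP => i.
    rewrite mem_index_iota => /andP[i_gt0 i_le] /=.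
    have [] := hp i; first by rewrite i_gt0 ltnW.
    by move/prime_gt0; rewrite lt0n.
  rewrite Nabs lognM ?muln_gt0 ?expn_gt0 ?Q_gt0 ?q_gt0 //.
  rewrite lognM ?expn_gt0 ?Q_gt0 // lognX.
  rewrite (logn_prime _ q_pr) eqxx (_ : logn q `|w| = 0%N) ?addn0 ?addn1 /=.
    by rewrite mul2n odd_double.
  by apply: logn_coprime; rewrite prime_coprime.
have q2 : coprime 2 q by rewrite coprime2n.
(* The prime [q] is not 5, because 5 is 1 modulo 4. *)
have q5 : coprime 5 q.
  rewrite prime_coprime // dvdn_prime2 //.
  by apply: contra_notN q_mod4 => /eqP <-.
(* A negative [N] gives 0 by the convention in [Bbar]; otherwise [N] is its own absolute value. *)
case: N {Nabs} odd_q => // m odd_q.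
have := num_overpartitions_dvd4 q5 q2 odd_q.
by rewrite /dvdn => /eqP /= ->.
Qed.
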